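(* Every Krivine tripos is (up to equivalence) the Booleanization of $[-,\mathcal{D}(A,A')]$ with respect to $U$, for some filtered opca $(A,A')$ and some downwards closed subset $U$ of $A$ which does not meet $A'$, i.e. $U\cap A'=\emptyset$.
   Context: Filtered opcas. Application associates to the left; $xy\leq z$ includes that $xy$ is defined. An opca is a poset $(A,\leq)$ with a partial binary application $a,b\mapsto ab$ such that: (i) if $ab$ is defined, $a'\leq a$ and $b'\leq b$, then $a'b'$ is defined and $a'b'\leq ab$; (ii) there are $\mathsf{k},\mathsf{s}\in A$ such that $\mathsf{k}xy\leq x$ for all $x,y$; $\mathsf{s}xy$ is defined for all $x,y$; and whenever $xz(yz)$ is defined, $\mathsf{s}xyz\leq xz(yz)$. A filtered opca $(A,A')$ is an opca $A$ with a subset $A'\subseteq A$ (the filter) closed under (defined) application and containing choices for $\mathsf{k},\mathsf{s}$. The Set-indexed preorder $[-,A]$ (the filter is suppressed in the notation) assigns to a set $I$ the set of functions $I\to A$, with $\phi\leq\psi$ iff there is $a\in A'$ such that for all $i\in I$, $a\phi(i)$ is defined and $a\phi(i)\leq\psi(i)$; reindexing is composition. Equivalence means equivalence of Set-indexed preorders. Abstract Krivine structures. An aks consists of: a set $\Lambda$ with a binary operation $t,s\mapsto t\cdot s$ and elements $\mathsf{K},\mathsf{S},\mathsf{cc}\in\Lambda$; a subset $\mathsf{QP}\subseteq\Lambda$ containing $\mathsf{K},\mathsf{S},\mathsf{cc}$ and closed under $\cdot$; a set $\Pi$ with operations $\Lambda\times\Pi\to\Pi$, $(t,\pi)\mapsto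 t.\pi$ (associated to the right) and $\Pi\to\Lambda$, $\pi\mapsto k_\pi$; and a subset $\perp\!\!\!\perp\ \subseteq\Lambda\times\Pi$ such that for all $t,s,u\in\Lambda$, $\pi,\pi'\in\Pi$: (S1) $(t,s.\pi)\in\perp\!\!\!\perp$ implies $(t\cdot s,\pi)\in\perp\!\!\!\perp$; (S2) $(t,\pi)\in\perp\!\!\!\perp$ implies $(\mathsf{K},t.s.\pi)\in\perp\!\!\!\perp$; (S3) $((t\cdot u)\cdot(s\cdot u),\pi)\in\perp\!\!\!\perp$ implies $(\mathsf{S},t.s.u.\pi)\in\perp\!\!\!\perp$; (S4) $(t,k_\pi.\pi)\in\perp\!\!\!\perp$ implies $(\mathsf{cc},t.\pi)\in\perp\!\!\!\perp$; (S5) $(t,\pi)\in\perp\!\!\!\perp$ implies $(k_\pi,t.\pi')\in\perp\!\!\!\perp$. Krivine triposes. For $V\subseteq\Lambda$ let $V^{\perp\!\!\!\perp}=\{\pi\in\Pi\mid\forall t\in V\,(t,\pi)\in\perp\!\!\!\perp\}$; for $\alpha\subseteq\Pi$ let $|\alpha|=\alpha^{\perp\!\!\!\perp}=\{t\in\Lambda\mid\forall\pi\in\alpha\,(t,\pi)\in\perp\!\!\!\perp\}$. Let $\mathcal{P}_{\perp\!\!\!\perp}(\Pi)=\{\beta\subseteq\Pi\mid(\beta^{\perp\!\!\!\perp})^{\perp\!\!\!\perp}=\beta\}$, ordered by reverse inclusion, with total application $\alpha\bullet\beta=(X^{\perp\!\!\!\perp})^{\perp\!\!\!\perp}$ where $X=\{\pi\in\Pi\mid\forall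 t\in|\alpha|\,\forall s\in|\beta|\ (t,s.\pi)\in\perp\!\!\!\perp\}$, and filter $\Phi=\{\alpha\in\mathcal{P}_{\perp\!\!\!\perp}(\Pi)\mid|\alpha|\cap\mathsf{QP}\neq\emptyset\}$. This is a filtered opca and $[-,\mathcal{P}_{\perp\!\!\!\perp}(\Pi)]$ is a Boolean tripos (Streicher). A Krivine tripos is a tripos of the form $[-,\mathcal{P}_{\perp\!\!\!\perp}(\Pi)]$ for an aks. Booleanization. $\mathcal{D}(A,A')$ is the filtered opca of downwards closed subsets of $A$ ordered by inclusion, with $\alpha\beta$ defined iff $ab$ is defined for all $a\in\alpha,b\in\beta$, in which case it is the downwards closure of $\{ab\mid a\in\alpha,b\in\beta\}$, and filter $\{\alpha\mid\alpha\cap A'\neq\emptyset\}$. For $\alpha\subseteq A$ let $\alpha\to U=\{a\in A\mid\text{for all }b\in\alpha,\ ab\text{ is defined and }ab\in U\}$, and for $\phi:I\to\mathcal{D}A$ let $(\phi\to U)(i)=\phi(i)\to U$. The Booleanization of $[-,\mathcal{D}(A,A')]$ with respect to $U$ has at a set $I$ all functions $\phi:I\to\mathcal{D}A$, with $\phi\leq\psi$ iff $\phi\leq((\psi\to U)\to U)$ in $[I,\mathcal{D}(A,A')]$ (equivalently, it is the sub-preorder of $[I,\mathcal{D}(A,A')]$ on those $\phi$ isomorphic to $(\phi\to U)\to U$).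
   Formalization: The condition that U does not meet A' is asserted only when the Krivine tripos is nondegenerate (not all elements of all fibres comparable); for a degenerate one, e.g. with pole all of Λ×Π, it cannot hold. The equivalence is asserted for every Krivine tripos. *)

(* Defs.v *)
From HB Require Import structures.
From mathcomp Require Import all_boot all_order.
From mathcomp Require Import boolp classical_sets.

Set Implicit Arguments.
Unset Strict Implicit.
Unset Printing Implicit Defensive.

Import Order.TTheory.
Local Open Scope classical_set_scope.
Local Open Scope order_scope.

Record indexed_preorder := IndexedPreorder {
  fiber :> Type -> Type;
  fle : forall I, fiber I -> fiber I -> Prop;
  reindex : forall I J, (J -> I) -> fiber I -> fiber J;
  fle_refl : forall I (x : fiber I), fle x x;
  fle_trans : forall I (x y z : fiber I), fle x y -> fle y z -> fle x z;
  reindex_mono : forall I J (f : J -> I) (x y : fiber I),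
    fle x y -> fle (reindex f x) (reindex f y);
  reindex_id : forall I (x : fiber I),
    fle (reindex (fun i => i) x) x /\ fle x (reindex (fun i => i) x);
  reindex_comp : forall I J L (f : J -> I) (g : L -> J) (x : fiber I),
    fle (reindex (fun l => f (g l)) x) (reindex g (reindex f x)) /\
    fle (reindex g (reindex f x)) (reindex (fun l => f (g l)) x) }.

Definition fiso (P : indexed_preorder) I (x y : P I) := fle x y /\ fle y x.

(* Morphisms commute with reindexing up to isomorphism, as is usual for maps
   of indexed preorders. *)
Record indexed_morphism (P Q : indexed_preorder) := IndexedMorphism {
  imap :> forall I, P I -> Q I;
  imap_mono : forall I (x y : P I), fle x y -> fle (imap x) (imap y);
  imap_natural : forall I J (f : J -> I) (x : P I),
    fiso (imap (reindex f x)) (reindex f (imap x)) }.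

Definition equivalent (P Q : indexed_preorder) :=
  exists (F : indexed_morphism P Q) (G : indexed_morphism Q P),
    (forall I (x : P I), fiso (G I (F I x)) x) /\
    (forall I (y : Q I), fiso (F I (G I y)) y).

Definition degenerate (P : indexed_preorder) :=
  forall I (x y : P I), fle x y.

(* Partial application is a map [A -> A -> option A]; it is extended strictly
   to possibly undefined expressions. *)
Definition oapply A (app : A -> A -> option A) (x y : option A) : option A :=
  obind (fun a => obind (app a) y) x.

(* The expression [x] is defined and its value lies in [V]. *)
Definition oin A (x : option A) (V : set A) := exists2 c, x = Some c & V c.

Section Combinators.
Variables (d : Order.disp_t) (A : porderType d) (app : A -> A -> option A).

Notation "x \@ y" := (oapply app x y) (at level 40, left associativity).

Definition oleq (x : option A) (z : A) := oin x [set c | c <= z].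

Definition k_axiom (k : A) := forall x y,
  oleq (Some k \@ Some x \@ Some y) x.

Definition s_axiom (s : A) :=
  (forall x y, Some s \@ Some x \@ Some y) /\
  (forall x y z w, Some x \@ Some z \@ (Some y \@ Some z) = Some w ->
     oleq (Some s \@ Some x \@ Some y \@ Some z) w).

Record opca_axioms : Prop := OpcaAxioms {
  app_mono : forall a b c a' b', app a b = Some c -> a' <= a -> b' <= b ->
    oleq (app a' b') c;
  opca_ks : exists k s, k_axiom k /\ s_axiom s }.

Record filter_axioms (F : set A) : Prop := FilterAxioms {
  filter_app : forall a b c, F a -> F b -> app a b = Some c -> F c;
  filter_ks : exists k s, [/\ F k, F s, k_axiom k & s_axiom s] }.

End Combinators.

Record filtered_opca := FilteredOpca {
  opca_disp : Order.disp_t;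
  opca_carrier :> porderType opca_disp;
  app : opca_carrier -> opca_carrier -> option opca_carrier;
  filt : set opca_carrier;
  opcaP : opca_axioms app;
  filtP : filter_axioms app filt }.

Arguments filt : clear implicits.
Arguments app {_}.

Notation "x \@ y" := (oapply app x y) (at level 40, left associativity).

Section Calculus.
Variable A : filtered_opca.
Implicit Types x y z : option A.

(* if [y] is defined then so is [x], and [x <= y] *)
Definition ole x y := forall w, y = Some w -> oleq x w.

Lemma ole_refl x : ole x x.
Proof. by move=> w ->; exists w => //=. Qed.

Lemma ole_trans y x z : ole x y -> ole y z -> ole x z.
Proof.
move=> xy yz w /yz[v yv vw]; have [u xu uv] := xy _ yv.
by exists u => //=; exact: le_trans vw.
Qed.

Lemma ole_app x x' y y' : ole x x' -> ole y y' -> ole (x \@ y) (x' \@ y').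
Proof.
move=> xx' yy' w; case: x' xx' => [a|] // xa; case: y' yy' => [b|] // yb.
rewrite /= => ab.
have [a1 -> a1a] := xa _ erefl; have [b1 -> b1b] := yb _ erefl.
exact: (app_mono (opcaP A) ab).
Qed.

Lemma ole_appl x x' y : ole x x' -> ole (x \@ y) (x' \@ y).
Proof. by move=> xx'; apply: ole_app => //; exact: ole_refl. Qed.

Lemma ole_appr x y y' : ole y y' -> ole (x \@ y) (x \@ y').
Proof. by move=> yy'; apply: ole_app => //; exact: ole_refl. Qed.

Lemma ole_defined x y : ole x y -> y -> x.
Proof. by case: y => // b /(_ _ erefl)[c ->]. Qed.

Lemma ole_k k x y : k_axiom app k -> y -> ole (Some k \@ x \@ y) x.
Proof.
by move=> kP; case: y => // b _ w ->; exact: kP.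
Qed.

Lemma k_defined k x : k_axiom app k -> x -> Some k \@ x.
Proof.
move=> kP; case: x => // a _; have [c] := kP a a.
by case: (Some k \@ Some a).
Qed.

Lemma ole_s s x y z : s_axiom app s ->
  ole (Some s \@ x \@ y \@ z) (x \@ z \@ (y \@ z)).
Proof.
move=> [_ sP]; case: x => [a|] //; case: z => [c|]; last first.
  by move=> w; rewrite /oapply /=; case: y.
case: y => [b|] //; first by move=> w; exact: sP.
by move=> w; rewrite /oapply /=; case: (app a c).
Qed.

Lemma s_defined s x y : s_axiom app s -> x -> y -> Some s \@ x \@ y.
Proof. by move=> [sP _]; case: x => // a; case: y => // b _ _; exact: sP. Qed.

Lemma s_defined1 s x : s_axiom app s -> x -> Some s \@ x.
Proof.
move=> sP xd; have := s_defined sP xd xd.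
by case: (Some s \@ x).
Qed.

Lemma ole_i k s x : k_axiom app k -> s_axiom app s ->
  ole (Some s \@ Some k \@ Some k \@ x) x.
Proof.
move=> kP sP; apply: ole_trans (ole_s sP) _.
case: x => // a; apply: ole_k => //; exact: k_defined.
Qed.

Lemma filt_oapply x y (z : A) :
  x \@ y = Some z -> oin x (filt A) -> oin y (filt A) -> filt A z.
Proof.
by move=> + [a xa Fa] [b yb Fb]; rewrite xa yb; exact: (filter_app (filtP A)).
Qed.

Lemma oin_oapply x y :
  x \@ y -> oin x (filt A) -> oin y (filt A) -> oin (x \@ y) (filt A).
Proof.
move=> + xF yF; case E: (x \@ y) => [c|] // _.
by exists c => //; exact: filt_oapply E xF yF.
Qed.

Lemma oin_Some (a : A) : filt A a -> oin (Some a) (filt A).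
Proof. by move=> Fa; exists a. Qed.

End Calculus.

Section IndexedOpca.
Variable A : filtered_opca.

Definition opca_le I (phi psi : I -> A) :=
  exists2 a, filt A a & forall i, oleq (app a (phi i)) (psi i).

Lemma opca_le_refl I (phi : I -> A) : opca_le phi phi.
Proof.
have [k [s [Fk Fs kP sP]]] := filter_ks (filtP A).
have D : Some s \@ Some k \@ Some k by exact: s_defined.
have [e Ee Fe] : oin (Some s \@ Some k \@ Some k) (filt A).
  have D1 := @s_defined1 _ _ (Some k) sP isT.
  by do 2?[apply: oin_oapply => //; try exact: oin_Some].
exists e => // i.
have := @ole_i A k s (Some (phi i)) kP sP (phi i) erefl.
by rewrite Ee.
Qed.

Lemma opca_le_trans I (phi psi chi : I -> A) :
  opca_le phi psi -> opca_le psi chi -> opca_le phi chi.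
Proof.
have [k [s [Fk Fs kP sP]]] := filter_ks (filtP A).
move=> [a Fa aP] [b Fb bP].
have D1 : Some k \@ Some b by exact: k_defined.
have D2 := s_defined1 sP D1.
have D3 : Some s \@ (Some k \@ Some b) \@ Some a by exact: s_defined.
have [e Ee Fe] : oin (Some s \@ (Some k \@ Some b) \@ Some a) (filt A).
  by do 3?[apply: oin_oapply => //; try exact: oin_Some].
exists e => // i.
suff : ole (Some e \@ Some (phi i)) (Some (chi i)) by apply.
rewrite -Ee; apply: ole_trans (ole_s sP) _.
apply: (@ole_trans _ (Some b \@ Some (psi i))); last first.
  by move=> w [<-]; exact: bP.
apply: ole_app; first exact: ole_k.
by move=> w [<-]; exact: aP.
Qed.

Definition indexed_opca : indexed_preorder.
Proof.
refine (@IndexedPreorder (fun I => I -> A) opca_le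
  (fun I J f phi j => phi (f j)) opca_le_refl opca_le_trans _ _ _).
- by move=> I J f phi psi [a Fa aP]; exists a => // j; exact: aP.
- by move=> I phi; split; exact: opca_le_refl.
- by move=> I J L f g phi; split; exact: opca_le_refl.
Defined.

End IndexedOpca.

Definition down_closed d (A : porderType d) (al : set A) :=
  forall a b, al a -> b <= a -> al b.

Definition downset d (A : porderType d) :=
  {al : set A | `[< down_closed al >]}.

Section DownsetOrder.
Variables (d : Order.disp_t) (A : porderType d).

HB.instance Definition _ := SubChoice.on (downset A).
(* The canonical order on [set A] is inclusion. *)
HB.instance Definition _ := [SubChoice_isSubPOrder of downset A by <: with set_display].

Definition dset (al : downset A) : set A := val al.

Lemma downsetP (al : downset A) : down_closed (dset al).
Proof. exact/asboolP/(valP al). Qed.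

Lemma downset_leP (al be : downset A) :
  al <= be <-> dset al `<=` dset be.
Proof. by rewrite -subsetEset. Qed.

Definition mkdownset (al : set A) (al_dc : down_closed al) : downset A :=
  exist _ al (asboolT al_dc).

End DownsetOrder.

Section D.
Variable A : filtered_opca.
Implicit Types al be U : downset A.

Definition Dset al be : set A :=
  [set c | exists a b e, [/\ dset al a, dset be b, app a b = Some e & c <= e]].

Lemma Dset_down al be : down_closed (Dset al be).
Proof.
move=> c c' [a [b [e [? ? ? ce]]]] c'c; exists a, b, e; split=> //.
exact: le_trans ce.
Qed.

Definition Ddef al be := forall a b, dset al a -> dset be b -> app a b.

Definition Dapp al be : option (downset A) :=
  if `[< Ddef al be >] then Some (mkdownset (@Dset_down al be)) else None.

Definition Dfilt : set (downset A) := [set al | dset al `&` filt A !=set0].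

Lemma oin_down (x : option A) y U : ole x y -> oin y (dset U) -> oin x (dset U).
Proof.
move=> xy [c yc Uc]; have [b xb bc] := xy _ yc.
by exists b => //; exact: downsetP bc.
Qed.

Lemma DappP al be ga :
  (forall a b, dset al a -> dset be b -> oin (app a b) (dset ga)) <->
  oleq (Dapp al be) ga.
Proof.
split=> [H|[de]].
- have D : Ddef al be by move=> a b aa bb; have [c -> _] := H _ _ aa bb.
  rewrite /Dapp asboolT //; eexists; first by [].
  apply/downset_leP => c [a [b [e [aa bb abe ce]]]].
  have [e' + ge'] := H _ _ aa bb; rewrite abe => -[ee'].
  by apply: downsetP ce; rewrite ee'.
- rewrite /Dapp; case: asboolP => // D [<-] /downset_leP le_ga a b aa bb.
  have := D _ _ aa bb; case E: (app a b) => [c|] // _; exists c => //.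
  by apply: le_ga; exists a, b, c; split.
Qed.

Lemma Dapp_in al be de c : Dapp al be = Some de -> dset de c ->
  exists a b, [/\ dset al a, dset be b & ole (Some c) (app a b)].
Proof.
rewrite /Dapp; case: asboolP => // _ [<-] [a [b [e [aa bb abe ce]]]].
exists a, b; split=> // w; rewrite abe => -[<-]; by exists c.
Qed.

Lemma Dapp_mem al be de a b : Dapp al be = Some de -> dset al a -> dset be b ->
  oin (app a b) (dset de).
Proof.
rewrite /Dapp; case: asboolP => // D [<-] aa bb; have := D _ _ aa bb.
case E: (app a b) => [c|] // _; exists c => //.
by exists a, b, c; split.
Qed.

Definition principal (a : A) : downset A.
Proof.
apply: (@mkdownset _ A [set b | b <= a]) => b c ba cb; exact: le_trans ba.
Defined.

Lemma D_k k : k_axiom app k -> k_axiom Dapp (principal k).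
Proof.
move=> kP al be.
have [ka ka1 ka2] : exists2 ka, Dapp (principal k) al = Some ka &
    forall a b, dset ka a -> dset be b -> oin (app a b) (dset al).
  have D : Ddef (principal k) al.
    move=> k' a /= k'k aa; have : Some k \@ Some a by exact: k_defined.
    apply: (@ole_defined A (Some k' \@ Some a)); apply: ole_appl.
    by move=> w [<-]; exists k'.
  case E: (Dapp (principal k) al) => [ka|]; last first.
    by move: E; rewrite /Dapp asboolT.
  exists ka => // c b kac bb.
  have [k' [a [k'k aa cle]]] := Dapp_in E kac.
  apply: (@oin_down (Some c \@ Some b) (Some a)); last by exists a.
  apply: ole_trans (@ole_k A k (Some a) (Some b) kP isT).
  apply: ole_appl; apply: ole_trans cle _.
  by apply: (@ole_appl _ (Some k')) => w [<-]; exists k'.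
rewrite /oapply /= ka1 /=; exact/DappP.
Qed.

Lemma D_s s : s_axiom app s -> s_axiom Dapp (principal s).
Proof.
move=> sP.
have s1 al : exists2 sa, Dapp (principal s) al = Some sa &
    forall c, dset sa c -> exists2 a, dset al a & ole (Some c) (Some s \@ Some a).
  have D : Ddef (principal s) al.
    move=> s' a s's aa; have : Some s \@ Some a by exact: s_defined1.
    apply: (@ole_defined A (Some s' \@ Some a)); apply: ole_appl.
    by move=> w [<-]; exists s'.
  case E: (Dapp (principal s) al) => [sa|]; last first.
    by move: E; rewrite /Dapp asboolT.
  exists sa => // c sac; have [s' [a [s's aa cle]]] := Dapp_in E sac.
  exists a => //; apply: ole_trans cle _.
  by apply: (@ole_appl _ (Some s')) => w [<-]; exists s'.
have s2 al be : exists2 sab,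
    oapply Dapp (oapply Dapp (Some (principal s)) (Some al)) (Some be)
      = Some sab &
    forall c, dset sab c -> exists a b,
      [/\ dset al a, dset be b & ole (Some c) (Some s \@ Some a \@ Some b)].
  have [sa E1 sa1] := s1 al; rewrite {1}/oapply /= E1 /=.
  have D : Ddef sa be.
    move=> c b /sa1[a aa cle] bb.
    have : Some s \@ Some a \@ Some b by exact: s_defined.
    by apply: (@ole_defined A (Some c \@ Some b)); exact: ole_appl.
  case E: (Dapp sa be) => [sab|]; last by move: E; rewrite /Dapp asboolT.
  exists sab => // c sabc; have [c' [b [/sa1[a aa c'le] bb cle]]] := Dapp_in E sabc.
  exists a, b; split=> //; apply: ole_trans cle _.
  exact: (@ole_appl _ (Some c')).
split=> [al be|al be ga de]; first by have [sab -> _] := s2 al be.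
have [sab -> sab1] := s2 al be.
rewrite /oapply /=.
case E1: (Dapp al ga) => [ag|] //=; case E2: (Dapp be ga) => [bg|] //= E3.
apply/DappP => c g /sab1[a [b [aa bb cle]]] gg.
apply: (@oin_down (Some c \@ Some g) (Some s \@ Some a \@ Some b \@ Some g)).
  exact: ole_appl.
apply: oin_down (ole_s sP) _.
rewrite /oapply /=.
have [u -> agu] := Dapp_mem E1 aa gg.
have [v -> bgv] := Dapp_mem E2 bb gg.
exact: Dapp_mem E3 agu bgv.
Qed.

Lemma D_opca : opca_axioms Dapp.
Proof.
split=> [al be ga al' be' abE /downset_leP al'al /downset_leP be'be|].
  apply/DappP => a b aa bb; exact: Dapp_mem abE (al'al _ aa) (be'be _ bb).
have [k [s [kP sP]]] := opca_ks (opcaP A).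
by exists (principal k), (principal s); split; [exact: D_k|exact: D_s].
Qed.

Lemma D_filter : filter_axioms Dapp Dfilt.
Proof.
split=> [al be ga [a [aa Fa]] [b [bb Fb]] E|].
  have [c ab gc] := Dapp_mem E aa bb; exists c; split=> //.
  exact: (filter_app (filtP A)) ab.
have [k [s [Fk Fs kP sP]]] := filter_ks (filtP A).
exists (principal k), (principal s); split; [| |exact: D_k|exact: D_s].
- by exists k; split=> //=; exact: lexx.
- by exists s; split=> //=; exact: lexx.
Qed.

Definition D : filtered_opca := FilteredOpca D_opca D_filter.

Definition imp_set al U : set A :=
  [set a | forall b, dset al b -> oin (app a b) (dset U)].

Lemma imp_set_down al U : down_closed (imp_set al U).
Proof.
move=> a a' aP a'a b /aP; apply: (@oin_down (Some a' \@ Some b) (Some a \@ Some b)).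
by apply: ole_appl => w [<-]; exists a'.
Qed.

Definition imp al U : downset A := mkdownset (@imp_set_down al U).

(* [phi <= ((psi -> U) -> U)] in [[I, D(A, A')]] *)
Definition bool_le U I (phi psi : I -> downset A) :=
  @opca_le D I phi (fun i => imp (imp (psi i) U) U).

Lemma D_leP I (phi psi : I -> downset A) :
  @opca_le D I phi psi <->
  exists2 a, filt A a & forall i b, dset (phi i) b -> oin (app a b) (dset (psi i)).
Proof.
split=> [[al [a [aa Fa]] alP]|[a Fa aP]].
  by exists a => // i b ib; have /DappP := alP i; apply.
exists (principal a); first by exists a; split=> //=; exact: lexx.
move=> i; apply/DappP => a' b a'a ib.
apply: (@oin_down (Some a' \@ Some b) (Some a \@ Some b)); last exact: aP.
by apply: ole_appl => w [<-]; exists a'.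
Qed.

Lemma bool_le_refl U I (phi : I -> downset A) : bool_le U phi phi.
Proof.
have [k [s [Fk Fs kP sP]]] := filter_ks (filtP A).
apply/D_leP; pose i := Some s \@ Some k \@ Some k.
have Di : i by exact: s_defined.
have Dk1 := @k_defined A k _ kP.
have Dsi : Some s \@ i by exact: s_defined1.
have D1 : Some k \@ (Some s \@ i) by exact: k_defined.
have D2 := s_defined1 sP D1.
have D3 : Some s \@ (Some k \@ (Some s \@ i)) \@ Some k by exact: s_defined.
have Dsk := @s_defined1 A s (Some k) sP isT.
have [e Ee Fe] : oin (Some s \@ (Some k \@ (Some s \@ i)) \@ Some k) (filt A).
  by do 6?[apply: oin_oapply => //; try exact: oin_Some].
exists e => // j p jp.
have L1 : ole (Some e \@ Some p) (Some s \@ i \@ (Some k \@ Some p)).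
  rewrite -Ee; apply: ole_trans (ole_s sP) _.
  by apply: ole_appl; exact: ole_k.
apply: (oin_down L1).
have Dkp : Some k \@ Some p by exact: k_defined.
have := s_defined sP Di Dkp.
case E: (Some s \@ i \@ (Some k \@ Some p)) => [c|] // _.
exists c => // r /(_ _ jp); apply: oin_down.
rewrite -[app c r]/(Some c \@ Some r) -E.
apply: ole_trans (ole_s sP) _.
apply: (@ole_app _ _ (Some r) _ (Some p)); first exact: ole_i.
exact: ole_k.
Qed.

Lemma bool_le_trans U I (phi psi chi : I -> downset A) :
  bool_le U phi psi -> bool_le U psi chi -> bool_le U phi chi.
Proof.
have [k [s [Fk Fs kP sP]]] := filter_ks (filtP A).
move=> /D_leP[a Fa aP] /D_leP[b Fb bP]; apply/D_leP.
(* e = \p r. a p (\q. b q r) *)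
pose m := Some s \@ (Some k \@ (Some s \@ Some b)) \@ Some k.
pose t := Some s \@ (Some k \@ Some s) \@ (Some s \@ (Some k \@ Some k) \@ Some a).
have Dsb := @s_defined1 A s (Some b) sP isT.
have Dksb := k_defined kP Dsb.
have Dsksb := s_defined1 sP Dksb.
have Dm : m by exact: s_defined.
have Dkm := k_defined kP Dm.
have Dks := @k_defined A k (Some s) kP isT.
have Dsks := s_defined1 sP Dks.
have Dkk := @k_defined A k (Some k) kP isT.
have Dskk := s_defined1 sP Dkk.
have Dskka : Some s \@ (Some k \@ Some k) \@ Some a by exact: s_defined.
have Dt : t by exact: s_defined.
have Dst := s_defined1 sP Dt.
have De : Some s \@ t \@ (Some k \@ m) by exact: s_defined.
have [e Ee Fe] : oin (Some s \@ t \@ (Some k \@ m)) (filt A).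
  by do 20?[apply: oin_oapply => //; try exact: oin_Some].
exists e => // i p ip.
have [c apc cP] := aP i p ip.
have L1 : ole (Some e \@ Some p) (Some s \@ (Some k \@ Some c) \@ m).
  rewrite -Ee; apply: ole_trans (ole_s sP) _.
  apply: ole_app; last exact: ole_k.
  apply: ole_trans (ole_s sP) _; apply: ole_app; first exact: ole_k.
  apply: ole_trans (ole_s sP) _; apply: ole_app; first exact: ole_k.
  by rewrite {1}/oapply /= apc; exact: ole_refl.
apply: (oin_down L1).
have Dkc := @k_defined A k (Some c) kP isT.
have := s_defined sP Dkc Dm.
case E: (Some s \@ (Some k \@ Some c) \@ m) => [f|] // _.
exists f => // r ir.
have Dkr := @k_defined A k (Some r) kP isT.
have := @s_defined A s (Some b) _ sP isT Dkr.
case Eq: (Some s \@ Some b \@ (Some k \@ Some r)) => [q|] // _.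
have L2 : ole (Some f \@ Some r) (Some c \@ Some q).
  rewrite -E; apply: ole_trans (ole_s sP) _.
  apply: ole_app; first exact: ole_k.
  rewrite -Eq; apply: ole_trans (ole_s sP) _.
  by apply: ole_appl; exact: ole_k.
apply: (oin_down L2); apply: cP => v iv.
apply: (@oin_down (Some q \@ Some v) (Some b \@ Some v \@ Some r)).
  rewrite -Eq; apply: ole_trans (ole_s sP) _.
  by apply: ole_appr; exact: ole_k.
have [w bv wP] := bP i v iv.
by rewrite /oapply /= bv; exact: wP.
Qed.

Definition booleanization U : indexed_preorder.
Proof.
refine (@IndexedPreorder (fun I => I -> downset A) (@bool_le U)
  (fun I J f phi j => phi (f j)) (@bool_le_refl U) (@bool_le_trans U) _ _ _).
- by move=> I J f phi psi [a Fa aP]; exists a => // j; exact: aP.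
- by move=> I phi; split; exact: bool_le_refl.
- by move=> I J L f g phi; split; exact: bool_le_refl.
Defined.

(* If [U] does not meet the filter then the Booleanization is nondegenerate;
   hence a degenerate Krivine tripos (e.g. one whose pole is everything) is not
   equivalent to any such Booleanization. *)
Lemma booleanization_nondegenerate U :
  dset U `&` filt A = set0 -> ~ degenerate (booleanization U).
Proof.
move=> UF deg.
have T : down_closed [set: A] by [].
have N : down_closed (set0 : set A) by [].
have := deg unit (fun=> mkdownset T) (fun=> mkdownset N).
move=> /D_leP[a Fa /(_ tt a I)[c aac cP]].
have [//|e cae Ue] := cP a; suff : (dset U `&` filt A) e by rewrite UF.
split=> //; apply: (filter_app (filtP A)) cae => //.
exact: (filter_app (filtP A)) aac.
Qed.

End D.

Record aks := Aks {
  term : Type;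
  stack : Type;
  tapp : term -> term -> term;
  tK : term;
  tS : term;
  tcc : term;
  QP : set term;
  push : term -> stack -> stack;
  cont : stack -> term;
  pole : term -> stack -> Prop;
  QP_K : QP tK;
  QP_S : QP tS;
  QP_cc : QP tcc;
  QP_app : forall t s, QP t -> QP s -> QP (tapp t s);
  aksS1 : forall t s p, pole t (push s p) -> pole (tapp t s) p;
  aksS2 : forall t s p, pole t p -> pole tK (push t (push s p));
  aksS3 : forall t s u p, pole (tapp (tapp t u) (tapp s u)) p ->
    pole tS (push t (push s (push u p)));
  aksS4 : forall t p, pole t (push (cont p) p) -> pole tcc (push t p);
  aksS5 : forall t p p', pole t p -> pole (cont p) (push t p') }.

Section KrivineTripos.
Variable K : aks.
Implicit Types (V : set (term K)) (al be : set (stack K)).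

Definition orth_terms V : set (stack K) :=
  [set p | forall t, V t -> pole t p].

Definition orth_stacks al : set (term K) :=
  [set t | forall p, al p -> pole t p].

Definition biorth al := orth_terms (orth_stacks al).

Lemma orth_termsS V V' : V `<=` V' -> orth_terms V' `<=` orth_terms V.
Proof. by move=> VV' p pV' t /VV'; exact: pV'. Qed.

Lemma orth_stacksS al be : al `<=` be -> orth_stacks be `<=` orth_stacks al.
Proof. by move=> ab t tb p /ab; exact: tb. Qed.

Lemma sub_biorth al : al `<=` biorth al.
Proof. by move=> p ap t; apply. Qed.

Lemma biorth_orth V : biorth (orth_terms V) = orth_terms V.
Proof.
rewrite eqEsubset; split; last exact: sub_biorth.
by apply: orth_termsS => t Vt p; apply.
Qed.

(* The base type [(set _)^d] carries the opposite of inclusion, so the induced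
   order is reverse inclusion. *)
Definition closed_stacks := {be : (set (stack K))^d | biorth be == be}.

HB.instance Definition _ := SubChoice.on closed_stacks.
HB.instance Definition _ :=
  [SubChoice_isSubPOrder of closed_stacks by <: with Order.dual_display set_display].

Definition cset (be : closed_stacks) : set (stack K) := val be.

Lemma csetP (be : closed_stacks) : biorth (cset be) = cset be.
Proof. exact/eqP/(valP be). Qed.

Lemma closed_leP (be ga : closed_stacks) :
  be <= ga <-> cset ga `<=` cset be.
Proof. by rewrite -subsetEset. Qed.

Definition closure (al : set (stack K)) : closed_stacks :=
  exist _ (biorth al) (introT eqP (biorth_orth (orth_stacks al))).

(* [real be] is |be| *)
Definition real (be : closed_stacks) : set (term K) := orth_stacks (cset be).

Definition bullet_set (be ga : closed_stacks) : set (stack K) :=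
  [set p | forall t s, real be t -> real ga s -> pole t (push s p)].

Definition bullet (be ga : closed_stacks) : closed_stacks :=
  closure (bullet_set be ga).

Definition Phi : set closed_stacks := [set be | real be `&` @QP K !=set0].

Definition closed_app (be ga : closed_stacks) : option closed_stacks :=
  Some (bullet be ga).

Lemma real_bullet (be ga : closed_stacks) t s :
  real be t -> real ga s -> real (bullet be ga) (tapp t s).
Proof. by move=> bt gs p; apply=> q; move/(_ _ _ bt gs)/aksS1. Qed.

Lemma bullet_mem (be ga : closed_stacks) p :
  (forall t s, real be t -> real ga s -> pole t (push s p)) ->
  cset (bullet be ga) p.
Proof. by move=> H; exact: sub_biorth. Qed.

Lemma sub_closed (al : set (stack K)) (be : closed_stacks) :
  al `<=` cset be -> biorth al `<=` cset be.
Proof.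
by move=> ab; rewrite -csetP; apply: orth_termsS; exact: orth_stacksS.
Qed.

Definition closed_of_term (t : term K) : closed_stacks :=
  closure (orth_terms [set t]).

Lemma cset_of_term t : cset (closed_of_term t) = orth_terms [set t].
Proof. exact: biorth_orth. Qed.

Lemma real_of_term t : real (closed_of_term t) t.
Proof. by move=> p; rewrite cset_of_term; exact. Qed.

Lemma of_term_pole t u p :
  real (closed_of_term t) u -> pole t p -> pole u p.
Proof. by move=> + tp; apply; rewrite cset_of_term => _ ->. Qed.

Lemma closed_k : k_axiom closed_app (closed_of_term (@tK K)).
Proof.
move=> be ga; eexists; first by [].
apply/closed_leP => p bp; apply: bullet_mem => t s /(_ (push s p)) + gs.
apply; apply: bullet_mem => u v uK bv.
by apply: (of_term_pole uK); apply: aksS2; exact: bv.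
Qed.

Lemma closed_s : s_axiom closed_app (closed_of_term (@tS K)).
Proof.
split=> // al be ga w [<-]; eexists; first by [].
apply/closed_leP; apply: sub_closed => p Xp.
apply: bullet_mem => t3 u + gu; apply; apply: bullet_mem => t2 s + bs; apply.
apply: bullet_mem => t1 t St at_; apply: (of_term_pole St); apply: aksS3.
by apply: aksS1; apply: Xp; exact: real_bullet.
Qed.

Lemma closed_opca : opca_axioms closed_app.
Proof.
split=> [be ga de be' ga' [<-] /closed_leP b'b /closed_leP g'g|].
  eexists; first by []; apply/closed_leP; apply: sub_closed => p Xp.
  apply: bullet_mem => t s bt gs.
  by apply: Xp; [exact: orth_stacksS b'b _ bt|exact: orth_stacksS g'g _ gs].
exists (closed_of_term (@tK K)), (closed_of_term (@tS K)).
by split; [exact: closed_k|exact: closed_s].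
Qed.

Lemma closed_filter : filter_axioms closed_app Phi.
Proof.
split=> [be ga de [t [bt Qt]] [s [gs Qs]] [<-]|].
  by exists (tapp t s); split; [exact: real_bullet|exact: QP_app].
exists (closed_of_term (@tK K)), (closed_of_term (@tS K)); split.
- by exists (@tK K); split; [exact: real_of_term|exact: QP_K].
- by exists (@tS K); split; [exact: real_of_term|exact: QP_S].
- exact: closed_k.
- exact: closed_s.
Qed.

Definition krivine_opca : filtered_opca :=
  FilteredOpca closed_opca closed_filter.

Definition krivine_tripos : indexed_preorder := indexed_opca krivine_opca.

End KrivineTripos.

(* Main.v *)
Require Import Defs.
From HB Require Import structures.
From mathcomp Require Import all_boot all_order.
From mathcomp Require Import boolp classical_sets.

Local Open Scope classical_set_scope.

(** The filtered opca is the Krivine opca [A = krivine_opca K] itself, and [U]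
    ([falsum]) consists of its least element [bot], whose falsity value is all of
    [stack K].  The equivalence sends [phi] to the principal downsets generated
    by its values.

    What makes this work is that [A] has infinitary negations: for a downset
    [al] the element [refute al] is a largest [c], up to a realizer in the
    filter, with [c b <= bot] for all [b] in [al]; so it represents the downset
    [imp al U] of the Booleanization ([refute_app], [refute_univ]).  Writing
    [~a] for [refute (principal a)], a term [cont p] with [p] in the falsity
    value of [a] realizes [~a], and therefore [tcc] realizes that [~~a]
    implies [a] ([double_negation]).

    Two consequences give the equivalence.  The principal map reflects the
    order ([principal_reflect]): if [principal (phi i)] is below the double
    negation of [principal (psi i)], evaluating at [~psi i] shows
    [phi <= ~~psi <= psi].  It is also essentially surjective: [~(refute al)]
    represents the double [U]-negation of [al], because passing between
    [imp al U] and [refute al] costs only a realizer ([envelope_iso]).  The map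
    in the other direction is then forced to be [al |-> ~(refute al)].

    Finally, the realizers of an element below [bot] are orthogonal to every
    stack; if such an element is in the filter, it witnesses every inequality
    of the tripos, which is then degenerate ([falsum_filter]). *)

(** * Booleanizations of an arbitrary filtered opca *)

Section Generic.
Context {A : filtered_opca}.

Lemma principal_self (a : A) : dset (principal a) a.
Proof. exact: Order.POrderTheory.lexx. Qed.

Lemma bool_le_of_D (U : downset A) I (phi psi : I -> downset A) :
  @opca_le (D A) I phi psi -> bool_le U phi psi.
Proof.
by move=> le_phi; apply: opca_le_trans le_phi _; exact: bool_le_refl.
Qed.

Lemma principal_mono I (phi psi : I -> A) :
  opca_le phi psi ->
  @opca_le (D A) I (fun i => principal (phi i)) (fun i => principal (psi i)).
Proof.
move=> [a Fa aP]; apply/D_leP; exists a => // i b b_phi.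
have L : ole (Some a \@ Some b) (Some a \@ Some (phi i)).
  by apply: ole_appr => w [<-]; exists b.
exact: (@oin_down A _ _ (principal (psi i)) L (aP i)).
Qed.

(** The realizer is [fun x => s (k x) e], precomposition by [e]; in combinators,
    [s (s (k s) k) (k e)]. *)
Lemma filter_compose (e : A) : filt A e ->
  exists2 r, filt A r &
    forall x, exists2 y, app r x = Some y &
      forall z, ole (Some y \@ Some z) (Some x \@ (Some e \@ Some z)).
Proof.
have [k [s [Fk Fs kP sP]]] := filter_ks (filtP A); move=> Fe.
have Dks := @k_defined A k (Some s) kP isT.
have Dsks := s_defined1 sP Dks.
have Dw := @s_defined A s _ (Some k) sP Dks isT.
have Dke := @k_defined A k (Some e) kP isT.
have Dsw := s_defined1 sP Dw.
have Dr := s_defined sP Dw Dke.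
have [r Er Fr] : oin (Some s \@ (Some s \@ (Some k \@ Some s) \@ Some k)
    \@ (Some k \@ Some e)) (filt A).
  by do 20?[apply: oin_oapply => //; try exact: oin_Some].
exists r => // x.
have Dkx := @k_defined A k (Some x) kP isT.
have Dskxe := @s_defined A s _ (Some e) sP Dkx isT.
have L : ole (Some r \@ Some x) (Some s \@ (Some k \@ Some x) \@ Some e).
  rewrite -Er; apply: ole_trans (ole_s sP) _.
  apply: ole_app; last exact: ole_k.
  apply: ole_trans (ole_s sP) _; apply: ole_appl; exact: ole_k.
have : Some r \@ Some x by exact: ole_defined L Dskxe.
case E : (Some r \@ Some x) => [y|] // _; exists y => // z.
rewrite -E; apply: ole_trans (ole_appl L) _.
by apply: ole_trans (ole_s sP) _; apply: ole_appl; exact: ole_k.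
Qed.

End Generic.

(** * Negation in the Krivine opca *)

Section Krivine.
Variable K : aks.
Notation A := (krivine_opca K).
Implicit Types (a b c : A) (al : downset A).

Definition bot : A := Defs.closure (setT : set (stack K)).

Lemma real_bot b t p : (b <= bot)%O -> real b t -> pole t p.
Proof. by move=> /closed_leP b_bot; apply; apply/b_bot/sub_biorth. Qed.

(** The meet over [b] in [al] of the implications from [b] to [bot]. *)
Definition refute al : A :=
  Defs.closure [set q | exists b s p, [/\ dset al b, real b s & q = push s p]].

Definition falsum : downset A := principal bot.

Lemma le_refute a al :
  (forall b s p, dset al b -> real b s -> cset a (push s p)) ->
  (a <= refute al)%O.
Proof.
move=> H; apply/closed_leP/sub_closed => _ [b [s [p [al_b b_s ->]]]].
exact: H al_b b_s.
Qed.

Lemma real_refute al t b s p :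
  real (refute al) t -> dset al b -> real b s -> pole t (push s p).
Proof. by move=> tP ? ?; apply: tP; apply: sub_biorth; exists b, s, p. Qed.

Lemma refute_app al : dset (imp al falsum) (refute al).
Proof.
move=> b al_b; eexists; first by [].
apply/closed_leP => p _; apply: bullet_mem => t s tP b_s.
exact: real_refute tP al_b b_s.
Qed.

Definition identity_term : term K := tapp (tapp (@tS K) (@tK K)) (@tK K).

Definition apply_term : term K := tapp (@tS K) (tapp (@tK K) identity_term).

Lemma identity_pole t p : pole t p -> pole identity_term (push t p).
Proof.
by move=> tp; do 2![apply: aksS1]; apply: aksS3; do 2![apply: aksS1];
  exact: aksS2.
Qed.

(** The converse of axiom (S1), up to a proof-like term: an application that
    is orthogonal to [p] can be unfolded onto the stack. *)
Lemma apply_pole t s p :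
  pole (tapp t s) p -> pole apply_term (push t (push s p)).
Proof.
move=> tsp; apply: aksS1; apply: aksS3; do 3![apply: aksS1].
exact: aksS2 (identity_pole _ _ tsp).
Qed.

Lemma Phi_of_term t : @QP K t -> Phi (closed_of_term t).
Proof. by exists t; split=> //; exact: real_of_term. Qed.

Lemma QP_apply : @QP K apply_term.
Proof. by do !apply: QP_app; (exact: QP_S || exact: QP_K). Qed.

Definition applier : A := closed_of_term apply_term.

Lemma filt_applier : filt A applier.
Proof. exact: Phi_of_term QP_apply. Qed.

(** A realizer of [c] may refute each [b] in [al] only through application,
    not against stacks [push s p] directly; [apply_term] bridges the gap. *)
Lemma refute_univ al c :
  dset (imp al falsum) c -> oleq (app applier c) (refute al).
Proof.
move=> cP; eexists; first by [].
apply: le_refute => b s p al_b b_s; apply: bullet_mem => t u tE c_u.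
apply: (of_term_pole tE); apply: apply_pole.
have [_ [<-] cb_bot] := cP b al_b.
exact: real_bot cb_bot (real_bullet c_u b_s).
Qed.

Definition neg a : A := refute (principal a).

(** A term realizing an element below [a] is orthogonal to [p], and by (S5) a
    captured continuation discards its own stack in favour of [p]. *)
Lemma real_cont a p : cset a p -> real (neg a) (@cont K p).
Proof.
move=> a_p q; apply=> _ [b [s [r [/closed_leP b_a b_s ->]]]].
by apply: aksS5; exact: b_s (b_a _ a_p).
Qed.

Lemma double_negation a :
  oleq (app (closed_of_term (@tcc K) : A) (neg (neg a))) a.
Proof.
eexists; first by [].
apply/closed_leP => p a_p; apply: bullet_mem => t s tcc_t sP.
apply: (of_term_pole tcc_t); apply: aksS4.
exact: real_refute sP (principal_self _) (real_cont _ _ a_p).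
Qed.

Lemma falsum_filter : ~ degenerate (krivine_tripos K) ->
  dset falsum `&` filt A = set0.
Proof.
move=> ndeg; rewrite -subset0 => b [b_bot Fb]; apply: ndeg => I phi psi.
exists b => // i; eexists; first by [].
apply/closed_leP => p _; apply: bullet_mem => t s b_t _.
exact: real_bot b_bot b_t.
Qed.

(** * The equivalence *)

Lemma principal_reflect I (phi psi : I -> A) :
  bool_le falsum (fun i => principal (phi i)) (fun i => principal (psi i)) ->
  opca_le phi psi.
Proof.
move=> /D_leP[e Fe eP].
apply: (@opca_le_trans A I _ (fun i => neg (neg (psi i)))); last first.
  exists (closed_of_term (@tcc K)); last by move=> i; exact: double_negation.
  by apply: Phi_of_term; exact: QP_cc.
apply: (@opca_le_trans A I _ (fun i => bullet e (phi i))).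
  by exists e => // i; eexists; [|exact: Order.POrderTheory.lexx].
exists applier => [|i]; first exact: filt_applier.
(* The double negation realized by [e] is tested against [neg (psi i)]. *)
apply: refute_univ => n n_neg.
have [_ [<-] ephiP] := eP i (phi i) (principal_self _).
by apply: ephiP; exact: downsetP (refute_app _) n_neg.
Qed.

(** The element of the opca that represents [al] in the Booleanization; it
    encodes the existential quantification over [al] by its double negation,
    since application need not preserve the joins of the order. *)
Definition envelope al : A := neg (refute al).

(** Already in the downset opca, [principal (envelope al)] is isomorphic to the
    double negation [imp (imp al falsum) falsum].  In one direction a realizer
    [c] of [imp al falsum] becomes one of [refute al] by [refute_univ], hence
    the composition [fun g c => g (applier c)]; in the other, [refute al] is
    itself a member of [imp al falsum]. *)
Lemma envelope_iso I (phi : I -> downset A) :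
  fiso (P := booleanization falsum) (fun i => principal (envelope (phi i))) phi.
Proof.
split.
  have [r Fr rP] := filter_compose _ filt_applier.
  apply/D_leP; exists r => // i g g_env.
  have [y ry yP] := rP g; exists y => // c cP.
  have [n En n_ref] := refute_univ _ _ cP.
  apply: (oin_down (yP c)).
  have -> : Some applier \@ Some c = Some n by exact: En.
  have g_imp : dset (imp (principal (refute (phi i))) falsum) g.
    exact: downsetP (refute_app _) g_env.
  exact: g_imp n_ref.
apply: (@bool_le_of_D A).
apply: (@opca_le_trans (D A) I _ (fun i => imp (imp (phi i) falsum) falsum)).
  exact: (@bool_le_refl A).
apply/D_leP; exists applier => [|i b bP]; first exact: filt_applier.
apply: refute_univ => n n_ref.
by apply: bP; exact: downsetP (refute_app _) n_ref.
Qed.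

Definition principal_morphism :
  indexed_morphism (krivine_tripos K) (booleanization falsum).
Proof.
refine (@IndexedMorphism (krivine_tripos K) (booleanization falsum)
  (fun I phi i => principal (phi i : A)) _ _).
- by move=> I phi psi le_phi; apply: bool_le_of_D; exact: principal_mono.
- by move=> I J f phi; split; exact: bool_le_refl.
Defined.

Definition envelope_morphism :
  indexed_morphism (booleanization falsum) (krivine_tripos K).
Proof.
refine (@IndexedMorphism (booleanization falsum) (krivine_tripos K)
  (fun I phi i => envelope (phi i)) _ _).
- move=> I phi psi le_phi; apply: principal_reflect.
  have [env_phi _] := envelope_iso _ phi.
  have [_ psi_env] := envelope_iso _ psi.
  exact: (@bool_le_trans A falsum _ _ _ _ env_phi
    (@bool_le_trans A falsum _ _ _ _ le_phi psi_env)).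
- by move=> I J f phi; split; exact: opca_le_refl.
Defined.

Lemma krivine_equivalent :
  equivalent (krivine_tripos K) (booleanization falsum).
Proof.
exists principal_morphism, envelope_morphism; split=> I phi.
  have [le_phi ge_phi] := envelope_iso _ (fun i => principal (phi i : A)).
  by split; apply: principal_reflect; [exact: le_phi | exact: ge_phi].
exact: envelope_iso.
Qed.

End Krivine.

Theorem theorem2p8 (K : aks) :
  exists (A : filtered_opca) (U : downset A),
    (~ degenerate (krivine_tripos K) -> dset U `&` filt A = set0) /\
    equivalent (krivine_tripos K) (booleanization U).
Proof.
exists (krivine_opca K), (falsum K).
by split; [exact: falsum_filter | exact: krivine_equivalent].
Qed.
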